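(* Let $\alpha, L, \varepsilon_0$ be positive numbers with $0<\varepsilon_0\le 1$. Let $K\subset\mathbb{R}^d$ be a convex body with $K\subseteq B_d(0,1)$, and let $\mu$ be a probability measure on $\mathbb{R}^d$ whose support is contained in $K$, such that $$\mu\left(C_K(u,\varepsilon)\right)\ge L\varepsilon^\alpha\quad\text{for all } u\in\mathbb{S}^{d-1} \text{ and all } \varepsilon\in[0,\varepsilon_0].$$ Let $n\ge 1$ be an integer, let $X_1,\dots,X_n$ be i.i.d. random points with distribution $\mu$, and let $\hat K_n$ be their convex hull. Set $$\tau_1=\max\left(1,\frac{d}{C_\alpha\,\alpha L}\right),\qquad a_n=\left(\frac{\tau_1\ln n}{n}\right)^{1/\alpha},\qquad b_n=n^{-1/\alpha}.$$ Then $$\mathbb{P}\left[\mathsf{d}_{\mathsf H}(\hat K_n,K)\ge 2a_n+2b_nx\right]\le 12^d\exp\left(-C_\alpha L x^\alpha\right)$$ for all $x\ge 0$ with $a_n+b_nx\le\varepsilon_0$.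
   Context: $d$ is a positive integer. A convex body in $\mathbb{R}^d$ is a compact convex set with nonempty interior. $B_d(a,r)$ is the closed Euclidean ball in $\mathbb{R}^d$ with center $a$ and radius $r$; $\mathbb{S}^{d-1}$ is the Euclidean unit sphere. The support function of a compact set $A$ is $h_A(u)=\max\{\langle u,x\rangle: x\in A\}$. For a convex body $K$, $u\in\mathbb{S}^{d-1}$ and $\varepsilon\ge 0$, the cap is $C_K(u,\varepsilon)=\{x\in K:\langle u,x\rangle\ge h_K(u)-\varepsilon\}$. $\mathsf{d}_{\mathsf H}$ is the Hausdorff distance with respect to the Euclidean distance. For $\alpha>0$, $C_\alpha=\inf_{t>0}\frac{(1+t)^\alpha}{1+t^\alpha}$, which equals $1$ if $\alpha\ge 1$ and $2^{\alpha-1}$ otherwise. *)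

(* Defs.v *)
From HB Require Import structures.
From mathcomp Require Import all_boot all_order all_algebra.
From mathcomp Require Import all_classical all_reals all_analysis.

Set Implicit Arguments.
Unset Strict Implicit.
Unset Printing Implicit Defensive.
Import Order.TTheory GRing.Theory Num.Theory.
Import numFieldNormedType.Exports.
Local Open Scope classical_set_scope.
Local Open Scope ring_scope.

(* R^d is 'rV[R]_d. The norm that the library puts on this type is the maximum
   norm, so the Euclidean one is defined here; both induce the topology of
   'rV[R]_d, to which compact, interior and open below refer. *)
Definition dotp (R : realType) (d : nat) (u x : 'rV[R]_d) : R :=
  \sum_(i < d) u ord0 i * x ord0 i.

Definition enorm (R : realType) (d : nat) (x : 'rV[R]_d) : R :=
  Num.sqrt (dotp x x).

Definition eball (R : realType) (d : nat) (a : 'rV[R]_d) (r : R) :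
  set 'rV[R]_d := [set x | enorm (x - a) <= r].

Definition esphere (R : realType) (d : nat) : set 'rV[R]_d :=
  [set u | enorm u = 1].

Definition convex_body (R : realType) (d : nat) (K : set 'rV[R]_d) : Prop :=
  [/\ compact K, @convex_set R 'rV[R]_d K & interior K !=set0].

(* The supremum is a maximum when A is compact and nonempty. *)
Definition supp_fun (R : realType) (d : nat) (A : set 'rV[R]_d)
  (u : 'rV[R]_d) : R := sup [set dotp u x | x in A].

Definition cap (R : realType) (d : nat) (K : set 'rV[R]_d) (u : 'rV[R]_d)
  (eps : R) : set 'rV[R]_d :=
  [set x | K x /\ supp_fun K u - eps <= dotp u x].

Definition convex_hull (R : realType) (d : nat) (A : set 'rV[R]_d) :
  set 'rV[R]_d := smallest (@convex_set R 'rV[R]_d) A.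

(* Distances to sets and Hausdorff distances are extended real numbers, so
   that infima and suprema always have their usual values; the Hausdorff
   distance is finite between nonempty bounded sets. *)
Definition edist_to (R : realType) (d : nat) (x : 'rV[R]_d)
  (A : set 'rV[R]_d) : \bar R :=
  ereal_inf [set (enorm (x - a))%:E | a in A].

Definition hausdorff_dist (R : realType) (d : nat) (A B : set 'rV[R]_d) :
  \bar R :=
  maxe (ereal_sup [set edist_to a B | a in A])
       (ereal_sup [set edist_to b A | b in B]).

(* R^d with its Borel sigma-algebra. *)
Notation borel_rV R d := (g_sigma_algebraType (@open 'rV[R]_d)).

Definition measure_support (R : realType) (d : nat)
  (mu : probability (borel_rV R d) R) : set 'rV[R]_d :=
  [set x | forall U : set 'rV[R]_d, open U -> U x -> (0 < mu U)%E].

Definition mutually_independent (d1 d2 : measure_display)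
  (T : measurableType d1) (T' : measurableType d2) (R : realType)
  (P : probability T R) (I : finType) (X : I -> {RV P >-> T'}) : Prop :=
  forall (J : {set I}) (A : I -> set T'),
    (forall i, i \in J -> measurable (A i)) ->
    P (\bigcap_(i in [set` J]) (X i @^-1` A i)) =
    (\prod_(i in J) P (X i @^-1` A i))%E.

(* The two laws are compared on measurable sets only, because the value of a
   measure on other sets is unconstrained. *)
Definition has_law (d1 d2 : measure_display)
  (T : measurableType d1) (T' : measurableType d2) (R : realType)
  (P : probability T R) (X : {RV P >-> T'}) (mu : probability T' R) : Prop :=
  forall A : set T', measurable A -> distribution P X A = mu A.

Definition C_const (R : realType) (alpha : R) : R :=
  inf [set (1 + t) `^ alpha / (1 + t `^ alpha) | t in [set t : R | 0 < t]].

(* Main.v *)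
Require Import Defs.
From HB Require Import structures.
From mathcomp Require Import all_boot all_order all_algebra.
From mathcomp Require Import all_classical all_reals all_analysis.
From mathcomp Require Import ring lra.

Set Implicit Arguments.
Unset Strict Implicit.
Unset Printing Implicit Defensive.
Import Order.TTheory GRing.Theory Num.Theory.
Import numFieldNormedType.Exports.
Local Open Scope classical_set_scope.
Local Open Scope ring_scope.

(** Put [eps = a + b * x], so that the event is that the hull of the sample is at
    distance at least [2 * eps] from [K]. Almost surely the sample lies in [K]
    ([support_measure0]), so the distance is the largest excess, over unit
    vectors [u], of the support function of [K] over that of the hull
    ([hausdorff_separates]). An excess of about [2 * eps] at one [u] entails an
    excess greater than [eps] at any unit vector close enough to [u], hence at
    some point [v] of a fixed finite net of the sphere, which means that the cap
    of [K] of direction [v] and height [eps] contains no sample point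
    ([uncovered_cap]). By independence and the mass hypothesis, a given cap is
    empty with probability at most [(1 - L * eps `^ alpha) ^ n <=
    expR (- n * L * eps `^ alpha)] ([probability_all_miss]), so the union bound
    over the net yields the estimate [(12 / eps) ^ d *
    expR (- n * L * eps `^ alpha)].

    The constant [12] is that of the net, built by rounding on a grid and counted
    by a generating function ([sphere_net]). By definition of [C],
    [eps `^ alpha >= C * (a `^ alpha + (b * x) `^ alpha)], so the exponential is
    at most [n `^ (- C * L * tau1) * expR (- C * L * x `^ alpha)], and [tau1] is
    chosen so that the first factor compensates [eps^-1 ^ d]
    ([union_bound_at_rate]). This needs [ln n >= 1]; for [n <= 2] the right-hand
    side of the claim is at least [1] ([small_sample_bound]).

    The probability of the event is meaningful because it is measurable: strict
    separation by a direction can be tested on rational directions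
    ([measurable_hausdorff]). *)

(** * Euclidean norm and convex sets *)

Lemma continuous_sum (R : realType) (T : topologicalType) (I : finType)
    (f : I -> T -> R) :
  (forall i, continuous (f i)) -> continuous (fun x => \sum_i f i x).
Proof.
move=> cf; elim: (index_enum I) => [|i s IHs].
  rewrite (_ : (fun=> _) = cst 0); first exact: cst_continuous.
  by apply/funext => x; rewrite big_nil.
rewrite (_ : (fun=> _) = (fun x => f i x + \sum_(j <- s) f j x)).
  by move=> x; apply: cvgD; [exact: cf|exact: IHs].
by apply/funext => x; rewrite big_cons.
Qed.

Section Euclidean.
Context {R : realType} {d : nat}.
Implicit Types (u v x y : 'rV[R]_d) (k c : R).

Lemma dotpC u x : dotp u x = dotp x u.
Proof. by apply: eq_bigr => i _; rewrite mulrC. Qed.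

Lemma dotpDr u x y : dotp u (x + y) = dotp u x + dotp u y.
Proof. by rewrite -big_split; apply: eq_bigr => i _; rewrite mxE mulrDr. Qed.

Lemma dotpZr u k x : dotp u (k *: x) = k * dotp u x.
Proof. by rewrite mulr_sumr; apply: eq_bigr => i _; rewrite mxE mulrCA. Qed.

Lemma dotpNr u x : dotp u (- x) = - dotp u x.
Proof. by rewrite -scaleN1r dotpZr mulN1r. Qed.

Lemma dotpBr u x y : dotp u (x - y) = dotp u x - dotp u y.
Proof. by rewrite dotpDr dotpNr. Qed.

Lemma dotpDl u v x : dotp (u + v) x = dotp u x + dotp v x.
Proof. by rewrite dotpC dotpDr !(dotpC x). Qed.

Lemma dotpZl k u x : dotp (k *: u) x = k * dotp u x.
Proof. by rewrite dotpC dotpZr dotpC. Qed.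

Lemma dotpNl u x : dotp (- u) x = - dotp u x.
Proof. by rewrite dotpC dotpNr dotpC. Qed.

Lemma dotpBl u v x : dotp (u - v) x = dotp u x - dotp v x.
Proof. by rewrite dotpDl dotpNl. Qed.

Lemma dotpp_ge0 x : 0 <= dotp x x.
Proof. by apply: sumr_ge0 => i _; rewrite -expr2 sqr_ge0. Qed.

Lemma enorm_ge0 x : 0 <= enorm x.
Proof. exact: sqrtr_ge0. Qed.

Lemma enorm_sqr x : enorm x ^+ 2 = dotp x x.
Proof. by rewrite sqr_sqrtr ?dotpp_ge0. Qed.

Lemma enormZ k x : enorm (k *: x) = `|k| * enorm x.
Proof.
by rewrite /enorm dotpZl dotpZr mulrA -expr2 sqrtrM ?sqr_ge0// sqrtr_sqr.
Qed.

Lemma enormN x : enorm (- x) = enorm x.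
Proof. by rewrite -scaleN1r enormZ normrN1 mul1r. Qed.

Lemma enorm0 : enorm (0 : 'rV[R]_d) = 0.
Proof. by rewrite -(scale0r (0 : 'rV[R]_d)) enormZ normr0 mul0r. Qed.

Lemma enorm_eq0 x : enorm x = 0 -> x = 0.
Proof.
move=> x0; have : dotp x x == 0 by rewrite -enorm_sqr x0 expr0n.
rewrite psumr_eq0 => [/allP xx0|i _]; last by rewrite -expr2 sqr_ge0.
apply/rowP => i; rewrite mxE; apply/eqP.
rewrite -sqrf_eq0 expr2; exact: (implyP (xx0 i (mem_index_enum i)) isT).
Qed.

(** Cauchy-Schwarz, from the nonnegativity of [|x| u - |u| x] squared. *)
Lemma dotp_le_enorm u x : dotp u x <= enorm u * enorm x.
Proof.
have [/eqP/enorm_eq0 ->|u0] := boolP (enorm u == 0).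
  by rewrite -(scale0r (0 : 'rV[R]_d)) dotpZl mul0r mulr_ge0 ?enorm_ge0.
have [/eqP/enorm_eq0 ->|x0] := boolP (enorm x == 0).
  by rewrite -(scale0r (0 : 'rV[R]_d)) dotpZr mul0r mulr_ge0 ?enorm_ge0.
have ux_gt0 : 0 < enorm u * enorm x.
  by rewrite mulr_gt0// lt0r enorm_ge0 ?u0 ?x0.
have := dotpp_ge0 (enorm x *: u - enorm u *: x).
rewrite dotpBl !dotpBr !dotpZl !dotpZr (dotpC x u) -!enorm_sqr => h.
rewrite -(ler_pM2l ux_gt0); nra.
Qed.

Lemma enormD x y : enorm (x + y) <= enorm x + enorm y.
Proof.
rewrite -(@ler_pXn2r _ 2) ?nnegrE ?addr_ge0 ?enorm_ge0//.
rewrite enorm_sqr dotpDl !dotpDr (dotpC y x) -!enorm_sqr.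
have := dotp_le_enorm x y; nra.
Qed.

Lemma enorm_subZ_sqr x y k :
  enorm (x - k *: y) ^+ 2 = enorm x ^+ 2 - 2 * k * dotp x y + k * k * dotp y y.
Proof.
by rewrite !enorm_sqr dotpBl !dotpBr !dotpZl !dotpZr (dotpC y x); ring.
Qed.

Lemma enorm_unit x : x != 0 -> enorm ((enorm x)^-1 *: x) = 1.
Proof.
move=> x0; have nx : enorm x != 0 by apply: contra_neq x0 => /enorm_eq0.
by rewrite enormZ ger0_norm ?invr_ge0 ?enorm_ge0// mulVf.
Qed.

Lemma dotp_continuous u : continuous (dotp u).
Proof.
apply: (@continuous_sum _ _ _ (fun i (x : 'rV[R]_d) => u ord0 i * x ord0 i)).
move=> i x.
apply: (@continuousM _ _ (cst (u ord0 i)) (fun y : 'rV[R]_d => y ord0 i)).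
  exact: cst_continuous.
exact: coord_continuous.
Qed.

Lemma enorm_continuous : continuous (@enorm R d).
Proof.
move=> x; apply: continuous_comp; last exact: sqrt_continuous.
apply: (@continuous_sum _ _ _ (fun i (y : 'rV[R]_d) => y ord0 i * y ord0 i)).
by move=> i y; apply: (@continuousM _ _ (fun y : 'rV[R]_d => y ord0 i));
  exact: coord_continuous.
Qed.

Lemma continuous_enorm_dist k v : continuous (fun x => k * enorm (x - v)).
Proof.
move=> x.
apply: (@continuous_comp _ _ _ (fun y => enorm (y - v)) (fun t : R => k * t)).
  apply: (@continuous_comp _ _ _ (fun y : 'rV[R]_d => y - v) (@enorm R d)).
    apply: (@continuousB _ _ _ (fun y : 'rV[R]_d => y) (cst v)).
      exact: cvg_id.
    exact: cst_continuous.
  exact: enorm_continuous.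
exact: mulrl_continuous.
Qed.

Lemma closed_dotp_ge u c : closed [set x | c <= dotp u x].
Proof.
by apply: (@closed_comp _ _ (dotp u) [set t | c <= t]) => [x _|];
  [exact: dotp_continuous|exact: closed_ge].
Qed.

Lemma open_dotp_lt u c : open [set x | dotp u x < c].
Proof.
by apply: (@open_comp _ _ (dotp u) [set t | t < c]) => [x _|];
  [exact: dotp_continuous|exact: open_lt].
Qed.

Lemma open_dotp_gt u c : open [set x | c < dotp u x].
Proof.
by apply: (@open_comp _ _ (dotp u) [set t | c < t]) => [x _|];
  [exact: dotp_continuous|exact: open_gt].
Qed.

(** Convexity with plain real weights and propositional membership, the form in
    which inequalities are proved below. *)
Lemma convex_setP (A : set 'rV[R]_d) :
  @convex_set R 'rV[R]_d A <->
  forall x y k, 0 <= k -> k <= 1 -> A x -> A y -> A (k *: x + (1 - k) *: y).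
Proof.
split=> cA x y k.
  move=> k0 k1 /mem_set Ax /mem_set Ay.
  by have := cA x y (Itv01 k0 k1) Ax Ay; rewrite inE.
move=> /set_mem Ax /set_mem Ay; apply/mem_set/(cA x y k%:num) => //.
Qed.

Lemma convex_halfspace u c : @convex_set R 'rV[R]_d [set x | dotp u x < c].
Proof.
apply/convex_setP => x y k k0 k1 /=; rewrite dotpDr !dotpZr => xc yc.
have [->|k_neq0] := eqVneq k 0; first by rewrite mul0r add0r subr0 mul1r.
have kgt0 : 0 < k by rewrite lt0r k_neq0.
nra.
Qed.

Lemma convex_eball (M : R) : @convex_set R 'rV[R]_d (eball 0 M).
Proof.
apply/convex_setP => x y k k0 k1; rewrite /eball /= !subr0 => xM yM.
apply: (le_trans (enormD _ _)); rewrite !enormZ !ger0_norm ?subr_ge0//.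
have := enorm_ge0 x; nra.
Qed.

Lemma sub_convex_hull (A : set 'rV[R]_d) : A `<=` convex_hull A.
Proof. exact: sub_gen_smallest. Qed.

Lemma convex_hull_min (A B : set 'rV[R]_d) :
  @convex_set R 'rV[R]_d B -> A `<=` B -> convex_hull A `<=` B.
Proof. by move=> cB AB; apply: smallest_sub. Qed.

Lemma convex_convex_hull (A : set 'rV[R]_d) :
  @convex_set R 'rV[R]_d (convex_hull A).
Proof.
apply/convex_setP => x y k k0 k1 hx hy B [cB AB].
by apply: (convex_setP B).1 => //; [exact: hx|exact: hy].
Qed.

End Euclidean.

(** * Support functions, separation and the Hausdorff distance *)

Section Separation.
Context {R : realType} {d : nat}.
Implicit Types (u v x y q : 'rV[R]_d) (K A B : set 'rV[R]_d) (c M : R).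

Lemma supp_fun_attained K u : compact K -> K !=set0 ->
  exists2 k, K k & supp_fun K u = dotp u k.
Proof.
move=> cK K0.
have [|k /set_mem Kk kmax] := @compact_EVT_max _ _ (dotp u) K K0 cK.
  by apply: continuous_subspaceT; exact: dotp_continuous.
exists k => //; apply/eqP; rewrite eq_le; apply/andP; split.
  apply: ge_sup; first by exists (dotp u k); exists k.
  by move=> _ [y Ky <-]; apply: kmax; exact: mem_set.
apply: ub_le_sup; last by exists k.
by exists (dotp u k) => _ [y Ky <-]; apply: kmax; exact: mem_set.
Qed.

Lemma dotp_le_supp_fun K u y : compact K -> K y -> dotp u y <= supp_fun K u.
Proof.
move=> cK Ky; have K0 : K !=set0 by exists y.
apply: sup_upper_bound; last by exists y.
apply: compact_has_sup; first exact: image_nonempty.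
by apply: continuous_compact => //; apply: continuous_subspaceT;
  exact: dotp_continuous.
Qed.

Lemma supp_fun_le_dist K M u v : compact K -> K !=set0 -> K `<=` eball 0 M ->
  supp_fun K v <= supp_fun K u + M * enorm (v - u).
Proof.
move=> cK K0 KM; have [k Kk ->] := supp_fun_attained v cK K0.
have := dotp_le_supp_fun u cK Kk; have := dotp_le_enorm (v - u) k.
have := KM _ Kk; rewrite /eball /= subr0 dotpBl.
have := enorm_ge0 (v - u); nra.
Qed.

(** Take [b] in [B] at almost minimal distance from [a] and [v := a - b]. For
    any [b'] in [B], moving from [b] a small step [t] towards [b'] stays in [B],
    so it cannot bring the point much closer to [a]; expanding the square shows
    that [<v, b' - b>] is almost nonpositive. Hence [v] is an outer normal of
    [B] with a gap of nearly [|v|] times the distance. Working with an almost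
    minimiser and a strict inequality avoids asking [B] to be closed, which
    matters because [B] will be the convex hull of the sample. *)
Lemma separation_approx B M a c : @convex_set R 'rV[R]_d B -> B !=set0 ->
  B `<=` eball 0 M -> 0 < c -> (c%:E < edist_to a B)%E ->
  exists u, forall b, B b -> dotp u b < dotp u a - c * enorm u.
Proof.
move=> cB [b0 Bb0] BM c0 caB.
have [D cD DB] : exists2 D, c < D & forall b, B b -> D <= enorm (a - b).
  have le_dist b : B b -> (edist_to a B <= (enorm (a - b))%:E)%E.
    by move=> Bb; apply: ereal_inf_lbound; exists b.
  have fin : edist_to a B \is a fin_num.
    by rewrite fin_numElt (lt_trans _ caB) ?ltNyr//
      (le_lt_trans (le_dist _ Bb0)) ?ltry.
  exists (fine (edist_to a B)); first by rewrite -lte_fin fineK.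
  by move=> b /le_dist; rewrite -lee_fin fineK.
have M0 : 0 <= M by have := BM _ Bb0; apply: le_trans; exact: enorm_ge0.
pose S := [set enorm (a - b) ^+ 2 | b in B].
have hS : has_inf S.
  split; first by exists (enorm (a - b0) ^+ 2); exists b0.
  by exists 0 => _ [b _ <-]; exact: sqr_ge0.
(* [g] is the slack available in [<v, b' - b> < |v|^2 - c |v|]; the step [t] is
   small enough for the quadratic term, at most [4 M^2 t^2], to use up at most
   half of it, and [t * g] is the precision asked of the minimiser. *)
pose g := D * (D - c).
have g0 : 0 < g by rewrite mulr_gt0 ?subr_gt0// (lt_trans c0).
pose t := g / (4 * M ^+ 2 + g).
have den0 : 0 < 4 * M ^+ 2 + g by rewrite ltr_wpDl// mulr_ge0// sqr_ge0.
have t0 : 0 < t by rewrite divr_gt0.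
have t1 : t <= 1 by rewrite ler_pdivrMr// mul1r lerDr mulr_ge0// sqr_ge0.
have tg : 4 * M ^+ 2 * t <= g.
  have -> : g = t * (4 * M ^+ 2 + g) by rewrite divfK// gt_eqF.
  by rewrite mulrC ler_pM2l// lerDl ltW.
have tg0 : 0 < t * g by rewrite mulr_gt0.
have [_ [b Bb <-] bS] := inf_adherent tg0 hS.
exists (a - b) => b' Bb'; set v := a - b.
have vv : enorm v ^+ 2 = dotp v v by rewrite enorm_sqr.
have ge_inf b'' : B b'' -> inf S <= enorm (a - b'') ^+ 2.
  by move=> Bb''; apply: inf_lbound; [case: hS|exists b''].
have := ge_inf _ ((convex_setP B).1 cB _ _ _ (ltW t0) t1 Bb' Bb).
have -> : a - (t *: b' + (1 - t) *: b) = v - t *: (b' - b).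
  by apply/rowP => i; rewrite /v !mxE; ring.
set w := b' - b.
have w2M : dotp w w <= 4 * M ^+ 2.
  rewrite -enorm_sqr.
  have : enorm w <= 2 * M.
    have := BM _ Bb; have := BM _ Bb'; rewrite /eball /= !subr0.
    have := enormD b' (- b); rewrite enormN -/w; lra.
  have := enorm_ge0 w; nra.
rewrite enorm_subZ_sqr vv => h.
have {}h : 2 * t * dotp v w < t * g + t * t * dotp w w.
  by move: bS; rewrite -/v vv; lra.
have {}h : dotp v w < g.
  rewrite -(ltr_pM2l t0).
  have : t * (t * dotp w w) <= t * g.
    by rewrite ler_pM2l//; apply: le_trans tg; rewrite mulrC ler_pM2r.
  by lra.
have Dv : D <= enorm v by exact: DB.
have -> : dotp v b' = dotp v a - dotp v v + dotp v w.
  by rewrite -dotpBr -dotpDr; congr dotp; apply/rowP => i; rewrite !mxE; ring.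
rewrite -vv; suff : g <= enorm v ^+ 2 - c * enorm v by lra.
rewrite /g; nra.
Qed.

Lemma near_rational_rV (P : set 'rV[R]_d) u : (\forall x \near u, P x) ->
  exists q : 'rV[rat]_d, P (map_mx ratr q).
Proof.
move=> /nbhs_ballP[e /= e0 eP].
have h i : exists q : rat, ball (u ord0 i) e (ratr q).
  have ulte : u ord0 i - e < u ord0 i + e by lra.
  have [q] := rat_in_itvoo ulte; rewrite in_itv/= => /andP[q1 q2].
  by exists q; rewrite /ball/= ltr_norml; apply/andP; split; lra.
have [f fP] := choice h.
exists (\row_i f i); apply: eP; split => // i j.
by rewrite !mxE (ord1 i).
Qed.

Context {I : finType}.

(** [q] certifies that the Hausdorff distance between [K] and the convex hull
    of the [x i] is at least [c]: along [q], the support functions of the two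
    bodies differ by more than [c * |q|], the support function of the hull
    being the maximum of the [<q, x i>]. *)
Definition separates K (x : I -> 'rV[R]_d) c q : Prop :=
  (exists i, supp_fun K q + c * enorm q < dotp q (x i)) \/
  (forall i, dotp q (x i) < supp_fun K q - c * enorm q).

Lemma le_edist_to A a c q :
  (forall b, A b -> c * enorm q < `|dotp q (a - b)|) ->
  (c%:E <= edist_to a A)%E.
Proof.
move=> h; apply: le_ereal_inf_tmp => _ [b Ab <-]; rewrite lee_fin leNgt.
apply/negP => lt_c; have := h _ Ab; apply/negP; rewrite -leNgt.
have le_cs : `|dotp q (a - b)| <= enorm q * enorm (a - b).
  rewrite ler_norml dotp_le_enorm lerNl -dotpNl (le_trans (dotp_le_enorm _ _))//.
  by rewrite enormN.
by apply: (le_trans le_cs); rewrite mulrC ler_wpM2r ?enorm_ge0// ltW.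
Qed.

Lemma separates_hausdorff K (x : I -> 'rV[R]_d) c q : compact K -> K !=set0 ->
  0 <= c -> separates K x c q ->
  (c%:E <= hausdorff_dist (convex_hull (range x)) K)%E.
Proof.
move=> cK K0 c0 [[i qi]|qx]; rewrite /hausdorff_dist le_max; apply/orP.
- left; apply: (@le_trans _ _ (edist_to (x i) K)); last first.
    apply: ereal_sup_ubound; exists (x i) => //.
    by apply: sub_convex_hull; exists i.
  apply: (@le_edist_to _ _ _ q) => k Kk; apply: lt_le_trans (ler_norm _).
  by rewrite dotpBr; have := dotp_le_supp_fun q cK Kk; lra.
- right; have [k Kk kE] := supp_fun_attained q cK K0.
  apply: (@le_trans _ _ (edist_to k (convex_hull (range x)))); last first.
    by apply: ereal_sup_ubound; exists k.
  apply: (@le_edist_to _ _ _ q) => y hy; apply: lt_le_trans (ler_norm _).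
  have : dotp q y < supp_fun K q - c * enorm q.
    have cH := @convex_halfspace _ _ q (supp_fun K q - c * enorm q).
    apply: (convex_hull_min cH _ hy).
    by move=> _ [i _ <-]; exact: qx.
  by rewrite kE dotpBr; lra.
Qed.

(** The converse: a point of one body that is far from the other one is
    separated from it by some direction. The conditions on the direction are
    strict inequalities between continuous functions, so it can be taken
    rational; this is what makes the Hausdorff distance measurable. *)
Lemma hausdorff_separates K (x : I -> 'rV[R]_d) (i0 : I) c : convex_body K ->
  0 < c -> (c%:E < hausdorff_dist (convex_hull (range x)) K)%E ->
  exists q : 'rV[rat]_d, separates K x c (map_mx ratr q).
Proof.
move=> [cK convK [k0 /interior_subset Kk0]] c0.
have K0 : K !=set0 by exists k0.
have [M KM] : exists M, K `<=` eball 0 M.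
  have [|k Kk kmax] := @compact_EVT_max _ _ (@enorm R d) K K0 cK.
    by apply: continuous_subspaceT; exact: enorm_continuous.
  exists (enorm k) => y Ky; rewrite /eball/= subr0; apply: kmax; exact: mem_set.
have cenorm : continuous (fun q : 'rV[R]_d => c * enorm q).
  rewrite (_ : (fun q => _) = (fun q : 'rV[R]_d => c * enorm (q - 0))).
    exact: continuous_enorm_dist.
  by apply/funext => q; rewrite subr0.
rewrite /hausdorff_dist lt_max => /orP[|] /ereal_sup_gt[_ [a Aa <-] /=].
- move=> /(separation_approx convK K0 KM c0) [u ua].
  have [i ui] : exists i, supp_fun K u + c * enorm u < dotp u (x i).
    apply: contrapT => /forallNP nx.
    have [k Kk kE] := supp_fun_attained u cK K0.
    have : dotp u a < dotp u a.
      apply: (convex_hull_min (@convex_halfspace _ _ u (dotp u a)) _ Aa).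
      move=> _ [i _ <-] /=; have /negP := nx i.
      rewrite -leNgt => /le_lt_trans; apply.
      by rewrite kE; have := ua _ Kk; lra.
    by rewrite ltxx.
  (* The last term pays for replacing [supp_fun K q] by [supp_fun K u]. *)
  have [q qP] : exists q : 'rV[rat]_d,
      supp_fun K u < dotp (x i) (map_mx ratr q) - c * enorm (map_mx ratr q)
        - M * enorm (map_mx ratr q - u).
    apply: (@near_rational_rV (fun q => supp_fun K u <
      dotp (x i) q - c * enorm q - M * enorm (q - u)) u).
    apply: (@cvgr_gt _ _ (nbhs u) _ _
      (dotp (x i) u - c * enorm u - M * enorm (u - u))); last first.
      by rewrite subrr enorm0 dotpC; lra.
    apply: cvgB; last exact: continuous_enorm_dist.
    apply: cvgB; first exact: dotp_continuous.
    exact: cenorm.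
  exists q; left; exists i; move: qP; rewrite /= dotpC.
  by have := @supp_fun_le_dist K M u (map_mx ratr q) cK K0 KM; lra.
- have hM : convex_hull (range x) `<=` eball 0 (\sum_i enorm (x i)).
    apply: convex_hull_min; first exact: convex_eball.
    move=> _ [i _ <-]; rewrite /eball/= subr0 (bigD1 i)//= lerDl.
    by apply: sumr_ge0 => j _; exact: enorm_ge0.
  have h0 : convex_hull (range x) !=set0.
    by exists (x i0); apply: sub_convex_hull; exists i0.
  move=> /(separation_approx (@convex_convex_hull _ _ _) h0 hM c0) [u ua].
  have [q qP] : exists q : 'rV[rat]_d,
     forall i, 0 < dotp (a - x i) (map_mx ratr q) - c * enorm (map_mx ratr q).
    apply: (@near_rational_rV
      (fun q => forall i, 0 < dotp (a - x i) q - c * enorm q) u).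
    apply: (@filter_forall _ I
      (fun i q => 0 < dotp (a - x i) q - c * enorm q) (nbhs u) _) => i.
    apply: (@cvgr_gt _ _ (nbhs u) _ _
      (dotp (a - x i) u - c * enorm u)); last first.
      rewrite dotpC dotpBr; have : dotp u (x i) < dotp u a - c * enorm u.
        by apply: ua; apply: sub_convex_hull; exists i.
      lra.
    apply: cvgB; first exact: dotp_continuous.
    exact: cenorm.
  exists q; right => i; have := qP i; rewrite /= dotpC dotpBr.
  have := @dotp_le_supp_fun K (map_mx ratr q) a cK Aa; lra.
Qed.

End Separation.

(** * A finite net of the sphere *)

Section ExpBounds.
Context {R : realType}.

Lemma expR_ge_quadratic (x : R) : 0 <= x -> 1 + x + x ^+ 2 / 2 <= expR x.
Proof.
move=> x0; rewrite /expR.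
have <- : series (exp_coeff x) 3 = 1 + x + x ^+ 2 / 2.
  rewrite /series/= !big_nat_recr//= big_nil /exp_coeff /=.
  by rewrite expr0 expr1 add0r !divr1.
apply: nondecreasing_cvgn_le.
- by apply: nondecreasing_series => n _ _; exact: exp_coeff_ge0.
- exact: is_cvg_series_exp_coeff.
Qed.

Lemma expR1_le : expR 1 <= 14 / 5 :> R.
Proof.
have h : 19 / 20 <= expR (- (20^-1)) :> R.
  by have := expR_ge1Dx (- (20^-1) : R); lra.
have : (19 / 20) ^+ 20 <= expR (- (20^-1)) ^+ 20 :> R.
  by rewrite lerXn2r ?nnegrE ?expR_ge0//; lra.
rewrite -expRM_natl mulrN divff ?pnatr_eq0// expRN => h20.
have : 5 / 14 <= (expR 1)^-1 :> R by apply: le_trans h20; lra.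
by rewrite -[5 / 14]invrK lef_pV2 ?posrE ?expR_gt0// => ?; lra.
Qed.

End ExpBounds.

Section Net.
Context {R : realType}.

(** The integers from [- N] to [N - 1], as a finite type in which zero occurs
    once: [inl k] stands for [k] and [inr k] for [- k.+1]. Representing
    zero twice would spoil the constant of the net. *)
Definition signed_val N (y : 'I_N + 'I_N) : R :=
  match y with inl k => k%:R | inr k => - k.+1%:R end.

Definition signed_abs N (y : 'I_N + 'I_N) : nat :=
  match y with inl k => k | inr k => k.+1 end.

Lemma signed_normr N (y : 'I_N + 'I_N) : `|signed_val y| = (signed_abs y)%:R.
Proof. by case: y => k /=; rewrite ?normrN normr_nat. Qed.

Lemma round_toward0 (x B : R) : `|x| <= B ->
  exists y : 'I_(Num.truncn B).+1 + 'I_(Num.truncn B).+1,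
    `|x - signed_val y| <= 1 /\ `|signed_val y| <= `|x|.
Proof.
move=> xB; have := truncn_itv (normr_ge0 x).
set m := Num.truncn `|x|; move=> /andP[mx xm].
have mN : (m < (Num.truncn B).+1)%N by rewrite ltnS le_truncn.
have [x0|x0] := leP 0 x.
  rewrite ger0_norm// in mx xm *.
  exists (inl (Ordinal mN)) => /=; rewrite normr_nat; split=> //.
  by rewrite ler_norml; move: xm; rewrite -natr1; lra.
rewrite ltr0_norm// in mx xm *.
case: m mN mx xm => [|m] mN mx xm.
  exists (inl ord0) => /=; rewrite normr0 subr0 ltr0_norm//; split; lra.
exists (inr (Ordinal (ltnW mN))) => /=; rewrite normrN normr_nat; split=> //.
by move: mx xm; rewrite opprK ler_norml -!natr1; lra.
Qed.

Lemma sum_geometric_le N (q : R) : 0 < q -> q < 1 ->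
  \sum_(k < N) q ^+ k <= (1 - q)^-1.
Proof.
move=> q0 q1; rewrite -[leRHS]mul1r ler_pdivlMr ?subr_gt0//.
have := subrX1 q N; have := exprn_ge0 N (ltW q0); nra.
Qed.

Lemma sum_signed_geometric_le N (q : R) : 0 < q -> q < 1 ->
  \sum_(y : 'I_N + 'I_N) q ^+ signed_abs y <= (1 + q) / (1 - q).
Proof.
move=> q0 q1; rewrite big_sumType/= mulrDl mul1r.
under [X in _ + X]eq_bigr do rewrite exprS.
by rewrite -mulr_sumr lerD ?ler_wpM2l ?sum_geometric_le// ltW.
Qed.

(** Round [u / s], where [s = dl / sqrt d], towards zero, coordinate by
    coordinate. The error is at most [s] in each coordinate, hence at most [dl]
    in norm, and rounding towards zero never increases the norm, so the rounded
    point is [lam *: v] with [v] a unit vector and [lam <= 1].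
    The integer vectors [z] so obtained have [\sum_i |z i| <= sqrt d / s =
    d / dl], by Cauchy-Schwarz. Each of them satisfies
    [1 <= expR (d - dl * \sum_i |z i|)], and summing the right-hand side over
    all integer vectors factorises over the coordinates: their number is at most
    the [d]-th power of [e (1 + q) / (1 - q)] with [q = expR (- dl)]. This is a
    volume-free substitute for the usual packing bound on the size of a net. *)
Lemma sphere_net d (dl : R) : 0 < dl -> dl <= 49 / 100 ->
  exists s : seq 'rV[R]_d,
    [/\ forall v, v \in s -> enorm v = 1,
        (size s)%:R <= (147 / 25 / dl) ^+ d &
        forall u, enorm u = 1 -> exists2 v, v \in s &
          exists lam, [/\ 0 < lam, lam <= 1 & enorm (u - lam *: v) <= dl]].
Proof.
move=> dl0 dl1.
have [->|d_gt0] := posnP d.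
  exists [::]; split => [//|/=|u]; first by rewrite expr0.
  rewrite (_ : u = 0) ?enorm0; last by apply/rowP => -[].
  by move/eqP; rewrite eq_sym oner_eq0.
have sd0 : 0 < Num.sqrt d%:R :> R by rewrite sqrtr_gt0 ltr0n.
have sd2 : Num.sqrt d%:R ^+ 2 = d%:R :> R by rewrite sqr_sqrtr// ler0n.
pose s := dl / Num.sqrt d%:R.
have s0 : 0 < s by rewrite divr_gt0.
pose N := (Num.truncn s^-1).+1.
pose vec (z : {ffun 'I_d -> 'I_N + 'I_N}) : 'rV[R]_d := \row_i signed_val (z i).
pose Z := [pred z : {ffun 'I_d -> 'I_N + 'I_N} |
  (dl * (\sum_i signed_abs (z i))%:R <= d%:R) && (vec z != 0)].
exists [seq (enorm (vec z))^-1 *: vec z | z <- enum Z]; split.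
- by move=> v /mapP[z]; rewrite mem_enum => /andP[_ z0] ->; exact: enorm_unit.
- rewrite size_map -cardE -sum1_card natr_sum.
  apply: (@le_trans _ _ (\sum_(z : {ffun 'I_d -> 'I_N + 'I_N})
      (expR 1 ^+ d * \prod_i (expR (- dl)) ^+ signed_abs (z i)))).
    rewrite big_mkcond/=; apply: ler_sum => z _.
    rewrite prodrXr -!expRM_natl -expRD.
    case: ifPn => [/andP[zd _]|_]; last exact: expR_ge0.
    by rewrite -[leLHS]expR0 ler_expR mulr1 mulrN subr_ge0 mulrC.
  rewrite -mulr_sumr
    -(bigA_distr_bigA (fun (_ : 'I_d) y => expR (- dl) ^+ signed_abs y)).
  rewrite prodr_const card_ord -exprMn.
  have q1 : expR (- dl) < 1 by rewrite -expR0 ltr_expR oppr_lt0.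
  have q0 : 0 < expR (- dl) by exact: expR_gt0.
  have S0 : 0 <= \sum_(y : 'I_N + 'I_N) expR (- dl) ^+ signed_abs y.
    by apply: sumr_ge0 => y _; rewrite exprn_ge0 ?ltW.
  apply: lerXn2r; rewrite ?nnegrE.
  - by rewrite mulr_ge0 ?expR_ge0.
  - by rewrite !divr_ge0// ltW.
  apply: (@le_trans _ _ (14 / 5 * ((1 + expR (- dl)) / (1 - expR (- dl))))).
    by rewrite ler_pM ?expR_ge0 ?expR1_le// sum_signed_geometric_le.
  (* [e <= 14/5], and [dl <= 49/100] gives [(1 + q) / (1 - q) <= 21/10/dl]. *)
  have := expR_ge_quadratic (ltW dl0).
  rewrite expRN in q0 q1 *; set E := expR dl => EE.
  have E1 : 0 < E - 1 by nra.
  have E0 : 0 < E by lra.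
  have -> : (1 + E^-1) / (1 - E^-1) = 1 + 2 / (E - 1).
    by field; rewrite !gt_eqF//= ; lra.
  have : 2 / (E - 1) <= 2 / (dl + dl ^+ 2 / 2).
    by rewrite ler_pM2l// lef_pV2 ?posrE//; nra.
  have : 1 + 2 / (dl + dl ^+ 2 / 2) <= 21 / 10 / dl.
    have -> : 2 / (dl + dl ^+ 2 / 2) = 4 / (2 + dl) / dl.
      by field; rewrite !gt_eqF//=; nra.
    rewrite ler_pdivlMr// mulrDl divfK ?gt_eqF// -lerBrDl ler_pdivrMr; nra.
  have -> : 147 / 25 / dl = 14 / 5 * (21 / 10 / dl) by field; rewrite gt_eqF.
  by nra.
move=> u u1.
have uB i : `|u ord0 i / s| <= s^-1.
  rewrite normrM [X in _ * X]gtr0_norm ?invr_gt0//.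
  rewrite -[leRHS]mul1r ler_pM2r ?invr_gt0//.
  rewrite -(@ler_pXn2r _ 2) ?nnegrE// expr1n real_normK ?num_real//.
  rewrite -[leRHS](expr1n _ 2) -u1 enorm_sqr /dotp (bigD1 i)//= -expr2 lerDl.
  by apply: sumr_ge0 => j _; rewrite -expr2 sqr_ge0.
(* [z] are the rounded coordinates of [u / s] and [w] is the rounded [u]. *)
have [z zP] := choice (fun i => round_toward0 (uB i)).
have e1 i : `|u ord0 i - s * signed_val (z i)| <= s.
  have [+ _] := zP i; rewrite -(ler_pM2l s0) mulr1 -{1}(gtr0_norm s0) -normrM mulrBr.
  by rewrite mulrC divfK ?gt_eqF.
have e2 i : s * (signed_abs (z i))%:R <= `|u ord0 i|.
  have [_] := zP i; rewrite signed_normr normrM [X in _ * X]gtr0_norm ?invr_gt0//.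
  by rewrite ler_pdivlMr// mulrC.
pose w := s *: vec (finfun z).
have uw : enorm (u - w) <= dl.
  rewrite -(@ler_pXn2r _ 2) ?nnegrE ?enorm_ge0 ?(ltW dl0)// enorm_sqr.
  apply: (@le_trans _ _ (\sum_(i < d) s ^+ 2)).
    apply: ler_sum => i _; rewrite !mxE ffunE -expr2.
    by rewrite -real_normK ?num_real// ler_pXn2r ?nnegrE ?(ltW s0).
  by rewrite sumr_const card_ord -mulr_natl -sd2 -exprMn mulrC divfK ?gt_eqF.
have w1 : enorm w <= 1.
  rewrite -u1 -(@ler_pXn2r _ 2) ?nnegrE ?enorm_ge0// !enorm_sqr.
  apply: ler_sum => i _; rewrite !mxE ffunE -!expr2.
  rewrite -real_normK ?num_real// -[leRHS]real_normK ?num_real//.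
  rewrite ler_pXn2r ?nnegrE// normrM signed_normr gtr0_norm//.
have w0 : vec (finfun z) != 0.
  apply/eqP => w0; move: uw; rewrite /w w0 scaler0 subr0 u1; lra.
have vn0 : 0 < enorm (vec (finfun z)).
  by rewrite lt0r enorm_ge0 andbT; apply: contra_neq w0 => /enorm_eq0.
exists ((enorm (vec (finfun z)))^-1 *: vec (finfun z)).
  apply/mapP; exists (finfun z) => //; rewrite mem_enum !inE w0 andbT.
  rewrite natr_sum mulr_sumr.
  have dls : dl = s * Num.sqrt d%:R by rewrite divfK ?gt_eqF.
  apply: (@le_trans _ _ (Num.sqrt d%:R * \sum_i `|u ord0 i|)).
    rewrite mulr_sumr; apply: ler_sum => i _; rewrite ffunE.
    by rewrite dls mulrAC mulrC ler_pM2l.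
  rewrite -[leRHS]sd2 expr2 ler_pM2l//.
  have -> : \sum_i `|u ord0 i| = dotp (\row_i Num.sg (u ord0 i)) u.
    by apply: eq_bigr => i _; rewrite mxE -normrEsg.
  apply: (le_trans (dotp_le_enorm _ _)); rewrite u1 mulr1 ler_wsqrtr//.
  apply: (@le_trans _ _ (\sum_(i < d) 1)); last by rewrite sumr_const card_ord.
  apply: ler_sum => i _; rewrite !mxE -expr2 sqr_sg; by case: eqP.
exists (enorm w); rewrite scalerA.
have ww : enorm w = s * enorm (vec (finfun z)) by rewrite enormZ gtr0_norm.
by split => //; [rewrite ww mulr_gt0|rewrite {1}ww mulfK ?gt_eqF].
Qed.

End Net.

(** * The constant of superadditivity and the choice of the rates *)

Section Constant.
Context {R : realType} (alpha : R) (alpha_gt0 : 0 < alpha).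
Let S := [set (1 + t) `^ alpha / (1 + t `^ alpha) | t in [set t : R | 0 < t]].

Let lb_half : lbound S 2^-1.
Proof.
move=> _ [t /= t0 <-].
have ta := powR_ge0 t alpha.
rewrite ler_pdivlMr; last by lra.
have h1 : 1 <= (1 + t) `^ alpha.
  by rewrite -[leLHS](powRr0 (1 + t)) ler_powR ?ltW//; lra.
have ht : t `^ alpha <= (1 + t) `^ alpha.
  by rewrite ge0_ler_powR ?nnegrE ?ltW//; lra.
lra.
Qed.

Let S_neq0 : S !=set0.
Proof. by exists ((1 + 1) `^ alpha / (1 + 1 `^ alpha)); exists 1 => /=. Qed.

Lemma C_const_gt0 : 0 < C_const alpha.
Proof.
apply: (@lt_le_trans _ _ 2^-1); first by lra.
exact: lb_le_inf.
Qed.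

Lemma C_const_le t : 0 < t ->
  C_const alpha * (1 + t `^ alpha) <= (1 + t) `^ alpha.
Proof.
move=> t0; rewrite -ler_pdivlMr; last by have := powR_ge0 t alpha; lra.
by apply: ge_inf; [exists 2^-1; exact: lb_half|exists t].
Qed.

(** If [C > 1], the defining inequality at [t = C `^ alpha^-1 - 1] reads
    [C * (1 + t `^ alpha) <= C], which is absurd. *)
Lemma C_const_le1 : C_const alpha <= 1.
Proof.
rewrite leNgt; apply/negP => C1; set C := C_const alpha in C1 *.
have b1 : 1 < C `^ alpha^-1.
  have one : 1 `^ alpha^-1 = 1 :> R by rewrite powR1.
  rewrite -{1}one gt0_ltr_powR ?nnegrE ?invr_gt0//; lra.
have t0 : 0 < C `^ alpha^-1 - 1 by lra.
have := C_const_le t0.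
rewrite (addrC 1 (_ - 1)) subrK -powRrM mulVf ?gt_eqF// powRr1; last by lra.
by rewrite mulrDr mulr1 gerDl leNgt mulr_gt0 ?powR_gt0//; lra.
Qed.

Lemma C_const_superadditive s t : 0 <= s -> 0 <= t ->
  C_const alpha * (s `^ alpha + t `^ alpha) <= (s + t) `^ alpha.
Proof.
have C1 := C_const_le1.
have C0 := C_const_gt0.
move=> s0 t0; have [->|sn0] := eqVneq s 0.
  rewrite add0r powR0 ?gt_eqF// add0r; have := powR_ge0 t alpha; nra.
have [->|tn0] := eqVneq t 0.
  rewrite addr0 powR0 ?gt_eqF// addr0; have := powR_ge0 s alpha; nra.
have sgt0 : 0 < s by rewrite lt0r sn0.
have ts0 : 0 < t / s by rewrite divr_gt0// lt0r tn0.
have -> : s + t = s * (1 + t / s) by rewrite mulrDr mulr1 mulrC divfK.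
have -> : t `^ alpha = s `^ alpha * (t / s) `^ alpha.
  by rewrite -powRM// ?ltW// mulrC divfK.
rewrite [leRHS]powRM ?addr_ge0 ?(ltW ts0)// -[X in X + _]mulr1 -mulrDr mulrCA.
by rewrite ler_wpM2l ?powR_ge0// C_const_le.
Qed.

End Constant.

Section Rates.
Context {R : realType}.

Lemma powR_invK (alpha y : R) : 0 < alpha -> 0 <= y ->
  (y `^ alpha^-1) `^ alpha = y.
Proof. by move=> a0 y0; rewrite -powRrM mulVf ?gt_eqF// powRr1. Qed.

Lemma powR_rate (alpha : R) n : 0 < alpha ->
  (n%:R `^ (- alpha^-1)) `^ alpha = n%:R^-1 :> R.
Proof.
by move=> a0; rewrite -powRrM mulNr mulVf ?gt_eqF// powR_inv1.
Qed.

(** The defining property of [C_const] splits the exponent of the miss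
    probability at radius [a + b * x] into a logarithmic part, which absorbs the
    size of the net, and the tail in [x]. *)
Lemma rate_split (alpha tau x : R) n (C := C_const alpha)
    (a := (tau * ln n%:R / n%:R) `^ alpha^-1) (b := n%:R `^ (- alpha^-1)) :
  0 < alpha -> 0 <= tau -> (0 < n)%N -> 0 <= x ->
  C * (tau * ln n%:R + x `^ alpha) <= n%:R * (a + b * x) `^ alpha.
Proof.
move=> a0 t0 n0 x0.
have n1 : 1 <= n%:R :> R by rewrite ler1n.
have y0 : 0 <= tau * ln n%:R / n%:R.
  by rewrite divr_ge0 ?ler0n// mulr_ge0// ln_ge0.
have bx0 : 0 <= b * x by rewrite mulr_ge0 ?powR_ge0.
have := C_const_superadditive a0 (powR_ge0 _ _ : 0 <= a) bx0.
rewrite powR_invK// powRM ?powR_ge0// powR_rate// => h.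
have nn0 : 0 < n%:R :> R by rewrite ltr0n.
apply: le_trans (ler_wpM2l (ltW nn0) h).
rewrite le_eqVlt; apply/orP; left; apply/eqP; field.
by rewrite gt_eqF.
Qed.

Lemma ln_ge1 n : (3 <= n)%N -> 1 <= ln n%:R :> R.
Proof.
move=> n3; have n3R : 3 <= n%:R :> R by rewrite ler_nat.
rewrite -ler_expR lnK ?posrE; last by lra.
by have := @expR1_le R; lra.
Qed.

(** The factor [eps^-1 ^ d] is at most [n `^ (d / alpha)], since
    [eps >= a >= n `^ (- alpha^-1)]; the maximum in [tau] makes both
    [tau * ln n >= 1], used for that bound when [3 <= n], and
    [C * L * tau >= d / alpha], so that the logarithmic part of the exponent
    cancels that factor. *)
Lemma union_bound_at_rate d (alpha L x : R) n (C := C_const alpha)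
    (tau := Num.max 1 (d%:R / (C * alpha * L)))
    (a := (tau * ln n%:R / n%:R) `^ alpha^-1) (b := n%:R `^ (- alpha^-1))
    (eps := a + b * x) :
  0 < alpha -> 0 < L -> 0 <= x -> (3 <= n)%N ->
  (12 / eps) ^+ d * expR (- (n%:R * (L * eps `^ alpha)))
    <= 12 ^+ d * expR (- (C * L * x `^ alpha)).
Proof.
move=> a0 L0 x0 n3.
have n0 : (0 < n)%N by exact: leq_trans n3.
have nn0 : 0 < n%:R :> R by rewrite ltr0n.
have ln1 := ln_ge1 n3.
have tau1 : 1 <= tau by rewrite le_max lexx.
have C0 : 0 < C := C_const_gt0 a0.
have CaL : 0 < C * alpha * L by rewrite !mulr_gt0.
have taud : d%:R <= tau * (C * alpha * L).
  by rewrite -ler_pdivrMr// le_max lexx orbT.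
have h := @rate_split alpha tau x n a0 (le_trans ler01 tau1) n0 x0.
have e0 : expR (- (alpha^-1 * ln n%:R)) <= eps.
  apply: (@le_trans _ _ a); last by rewrite lerDl mulr_ge0 ?powR_ge0.
  have -> : expR (- (alpha^-1 * ln n%:R)) = n%:R^-1 `^ alpha^-1 :> R.
    by rewrite /powR invr_eq0 gt_eqF// lnV ?posrE// mulrN.
  have tl1 : 1 <= tau * ln n%:R by nra.
  rewrite ge0_ler_powR ?nnegrE ?invr_ge0 ?(ltW a0) ?ler0n//.
    by rewrite divr_ge0 ?ler0n//; lra.
  by rewrite -[leLHS]mul1r ler_pM2r ?invr_gt0.
have eps0 : 0 < eps by apply: lt_le_trans e0; exact: expR_gt0.
have einv : eps^-1 <= expR (alpha^-1 * ln n%:R).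
  by rewrite -[leRHS]invrK -expRN lef_pV2 ?posrE ?expR_gt0.
rewrite exprMn -[leLHS]mulrA ler_pM2l ?exprn_gt0//.
apply: (@le_trans _ _ (expR (alpha^-1 * ln n%:R) ^+ d *
    expR (- (L * (C * (tau * ln n%:R + x `^ alpha)))))).
  rewrite ler_pM ?exprn_ge0 ?invr_ge0 ?expR_ge0 ?(ltW eps0)//.
    by rewrite lerXn2r ?nnegrE ?expR_ge0 ?invr_ge0 ?(ltW eps0).
  by rewrite ler_expR lerN2 [leRHS]mulrCA ler_pM2l.
rewrite -expRM_natl -expRD ler_expR.
have : d%:R * (alpha^-1 * ln n%:R) <= L * (C * (tau * ln n%:R)).
  have -> : L * (C * (tau * ln n%:R)) =
      (tau * (C * alpha * L)) * (alpha^-1 * ln n%:R).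
    by field; rewrite gt_eqF.
  by rewrite ler_wpM2r// mulr_ge0 ?invr_ge0 ?(ltW a0)//; lra.
rewrite mulrDr; nra.
Qed.

(** With one or two points, [ln n < 1] and the previous estimate is lost, but
    then there is nothing to prove: caps have mass at most [1], so the exponent
    is at most [n <= 2], and [12 * exp (- 2) >= 1]. *)
Lemma small_sample_bound d (alpha L x tau : R) n (C := C_const alpha)
    (a := (tau * ln n%:R / n%:R) `^ alpha^-1) (b := n%:R `^ (- alpha^-1)) :
  0 < alpha -> 0 < L -> 0 <= tau -> 0 <= x -> (0 < d)%N -> (0 < n < 3)%N ->
  L * (a + b * x) `^ alpha <= 1 ->
  1 <= 12 ^+ d * expR (- (C * L * x `^ alpha)).
Proof.
move=> a0 L0 t0 x0 d0 /andP[n0 n3] Le.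
have h := @rate_split alpha tau x n a0 t0 n0 x0.
have n2 : n%:R <= 2 :> R by rewrite ler_nat.
have C0 := C_const_gt0 a0.
have ln0 : 0 <= ln n%:R :> R by rewrite ln_ge0// ler1n.
have CLx : C * L * x `^ alpha <= 2.
  have : L * (C * (tau * ln n%:R + x `^ alpha)) <=
      L * (n%:R * (a + b * x) `^ alpha).
    by rewrite ler_pM2l.
  have : L * (n%:R * (a + b * x) `^ alpha) <= 2.
    by rewrite mulrCA; apply: le_trans n2; rewrite -[leRHS]mulr1 ler_pM2l ?ltr0n.
  have : 0 <= L * (C * (tau * ln n%:R)) by rewrite !mulr_ge0// ltW.
  rewrite !mulrDr mulrCA (mulrA L C) (mulrC L) -/C; nra.
apply: (@le_trans _ _ (12 * expR (- 2))).
  rewrite expRN ler_pdivlMr ?expR_gt0// mul1r.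
  have -> : expR 2 = expR 1 ^+ 2 :> R by rewrite -expRM_natl mulr1.
  by have := @expR1_le R; have := expR_ge0 (1 : R); nra.
apply: ler_pM; rewrite ?expR_ge0 ?ler_expR ?lerN2//.
rewrite -[leLHS]expr1; apply: ler_weXn2l => //; lra.
Qed.

End Rates.

(** * Measurability and probability of the events *)

Section Measurability.
Context {R : realType} {d : nat}.

Lemma open_measurable_rV (U : set 'rV[R]_d) :
  open U -> measurable (U : set (borel_rV R d)).
Proof. by move=> oU; apply: sub_sigma_algebra. Qed.

Lemma closed_measurable_rV (F : set 'rV[R]_d) :
  closed F -> measurable (F : set (borel_rV R d)).
Proof.
move=> cF; rewrite -(setCK F); apply: measurableC; apply: open_measurable_rV.
exact: closed_openC.
Qed.

(** A point outside the support lies in an open null set. Such a set may be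
    taken in the countable family of balls with rational centre and radius
    [1 / (k + 1)], so the complement of the support is covered by countably many
    null sets. *)
Lemma support_measure0 (mu : probability (borel_rV R d) R) (K : set 'rV[R]_d) :
  closed K -> measure_support mu `<=` K -> mu (~` K) = 0%E.
Proof.
move=> cK suppK.
have mK : measurable (~` K : set (borel_rV R d)).
  by apply: open_measurable_rV; exact: closed_openC.
pose B (p : 'rV[rat]_d * nat) : set 'rV[R]_d :=
  @ball R 'rV[R]_d (map_mx ratr p.1) (p.2.+1%:R^-1).
have oB p : open (B p) by apply: ball_open; rewrite invr_gt0.
pose F (i : nat) : set (borel_rV R d) :=
  if unpickle i is Some p then (if mu (B p) == 0%E then B p else set0) else set0.
apply/negligibleP => //; apply: (@negligibleS _ _ _ _ (\bigcup_i F i)); last first.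
  apply: negligible_bigcup => i; rewrite /F.
  case: unpickle => [p|]; last exact: negligible_set0.
  case: ifPn => [/eqP Bp0|_]; last exact: negligible_set0.
  by apply/negligibleP => //; exact: open_measurable_rV.
move=> x nKx.
have [U [oU Ux U0]] : exists U, [/\ open U, U x & ~ (0 < mu U)%E].
  have : ~ measure_support mu x by move=> /suppK.
  rewrite /measure_support /= => /existsNP[U /not_implyP[oU /not_implyP[Ux U0]]].
  by exists U.
have /nbhs_ballP[e /= e0 eU] : nbhs x U by exact: open_nbhs_nbhs.
pose k := Num.truncn (2 / e).
have k0 : 0 < k.+1%:R^-1 :> R by rewrite invr_gt0.
have ke : k.+1%:R^-1 + k.+1%:R^-1 <= e.
  have := truncnS_gt (2 / e); rewrite -/k ltr_pdivrMr// => h.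
  rewrite -mulr2n -[leLHS]mulr_natl ler_pdivrMr//; rewrite mulrC; exact: ltW.
have [q qx] := near_rational_rV (nbhsx_ballx x _ k0).
have BU : B (q, k) `<=` U.
  by move=> y By; apply: eU; apply: le_ball ke _ _; exact: ball_triangle qx By.
exists (pickle (q, k)) => //; rewrite /F pickleK ifT; last first.
  rewrite eq_le measure_ge0 andbT leNgt; apply/negP => B0; apply: U0.
  apply: (lt_le_trans B0); apply: le_measure => //; rewrite inE;
    exact: open_measurable_rV.
exact: ball_sym.
Qed.

Context {disp : measure_display} {T : measurableType disp} (P : probability T R).
Context {n : nat} (X : 'I_n -> {RV P >-> borel_rV R d}).

Lemma measurable_separates (K : set 'rV[R]_d) c q :
  measurable [set w | separates K (fun i => X i w) c q].
Proof.
have -> : [set w | separates K (fun i => X i w) c q] =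
  (\bigcup_i (X i @^-1` [set x | supp_fun K q + c * enorm q < dotp q x])) `|`
  (\bigcap_i (X i @^-1` [set x | dotp q x < supp_fun K q - c * enorm q])).
  apply/seteqP; split => w [[i]|h]; [by left; exists i| |by left; exists i|].
  - by right => i _; exact: h.
  - by right => i; exact: h.
apply: measurableU.
  apply: fin_bigcup_measurable => // i _; apply: measurable_funPTI.
  by apply: open_measurable_rV; exact: open_dotp_gt.
apply: fin_bigcap_measurable => // i _; apply: measurable_funPTI.
by apply: open_measurable_rV; exact: open_dotp_lt.
Qed.

Lemma hausdorff_dist_ge0 I (x : I -> 'rV[R]_d) (K : set 'rV[R]_d) : K !=set0 ->
  (0 <= hausdorff_dist (convex_hull (range x)) K)%E.
Proof.
move=> [k Kk]; rewrite le_max; apply/orP; right.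
apply: (@le_trans _ _ (edist_to k (convex_hull (range x)))).
  by apply: le_ereal_inf_tmp => _ [y _ <-]; rewrite lee_fin enorm_ge0.
by apply: ereal_sup_ubound; exists k.
Qed.

Lemma lee_shrink (y : \bar R) (r : R) : 0 < r -> (0 <= y)%E ->
  (forall m, ((r * (1 - m.+2%:R^-1))%:E <= y)%E) -> (r%:E <= y)%E.
Proof.
move=> r0; case: y => [y| |]//=; rewrite ?leey//.
rewrite !lee_fin => y0 h; rewrite leNgt; apply/negP => yr.
have ry : 0 < r - y by rewrite subr_gt0.
have := h (Num.truncn (r / (r - y))); rewrite lee_fin.
have := truncnS_gt (r / (r - y)); set m := Num.truncn _.
rewrite ltr_pdivrMr// => hm; apply/negP; rewrite -ltNge mulrBr mulr1 ltrBrDr -ltrBrDl.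
rewrite ltr_pdivrMr//; apply: (lt_trans hm); rewrite mulrC ltr_pM2l// ltr_nat//.
Qed.

(** For [r > 0], the Hausdorff distance is at least [r] if and only if, for
    every [m], some rational direction certifies the level
    [r * (1 - 1 / (m + 2))]; this writes the event with countably many unions
    and intersections of measurable sets. *)
Lemma measurable_hausdorff (K : set 'rV[R]_d) r : convex_body K -> (0 < n)%N ->
  measurable [set w |
    (r%:E <= hausdorff_dist (convex_hull (range (fun i => X i w))) K)%E].
Proof.
move=> convK n0; have [cK _ [k0 /interior_subset Kk0]] := convK.
have K0 : K !=set0 by exists k0.
have [r0|r0] := leP r 0.
  rewrite (_ : [set w | _] = setT)//; apply/seteqP; split => // w _ /=.
  by apply: le_trans (hausdorff_dist_ge0 _ K0); rewrite lee_fin.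
pose c m := r * (1 - m.+2%:R^-1).
have cE m : 0 < c m /\ c m < r.
  have : m.+2%:R^-1 < 1 :> R by rewrite invf_lt1// ltr1n.
  have : 0 < m.+2%:R^-1 :> R by rewrite invr_gt0.
  move=> m0 m1; rewrite /c mulrBr mulr1 subr_gt0 gtrBl mulr_gt0// gtr_pMr//.
rewrite (_ : [set w | _] = \bigcap_m \bigcup_(q : 'rV[rat]_d)
    [set w | separates K (fun i => X i w) (c m) (map_mx ratr q)]).
  apply: bigcap_measurableType => m _; apply: countable_bigcupT_measurable => //.
  by move=> q; exact: measurable_separates.
apply/seteqP; split => w /= h.
  move=> m _; have [cm0 cmr] := cE m.
  have chd :
      ((c m)%:E < hausdorff_dist (convex_hull (range (fun i => X i w))) K)%E.
    by apply: lt_le_trans h; rewrite lte_fin.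
  have [q qP] := hausdorff_separates (Ordinal n0) convK cm0 chd.
  by exists q.
apply: lee_shrink => //; first exact: hausdorff_dist_ge0.
move=> m; have [q _] := h m I; apply: separates_hausdorff => //.
by have [/ltW] := cE m.
Qed.

Lemma measurable_cap (K : set 'rV[R]_d) u eps : closed K ->
  measurable (cap K u eps : set (borel_rV R d)).
Proof.
move=> cK; apply: (@measurableI _ (borel_rV R d) K); first exact: closed_measurable_rV.
by apply: closed_measurable_rV; exact: closed_dotp_ge.
Qed.

(** By independence the probability is [(1 - mu A) ^ n], and
    [1 - p <= expR (- p)]. *)
Lemma probability_all_miss (mu : probability (borel_rV R d) R)
    (A : set (borel_rV R d)) (p : R) :
  mutually_independent X -> (forall i, has_law (X i) mu) ->
  measurable A -> (p%:E <= mu A)%E ->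
  (P (\bigcap_i (X i @^-1` ~` A)) <= (expR (- (n%:R * p)))%:E)%E.
Proof.
move=> indX lawX mA pA.
have mAC : measurable (~` A) by exact: measurableC.
have -> : \bigcap_i (X i @^-1` ~` A) =
    \bigcap_(i in [set` [set: 'I_n]%SET]) (X i @^-1` ~` A).
  by apply/seteqP; split => w h i _; apply: h => //=; rewrite inE.
rewrite (indX _ (fun=> ~` A))//.
have fA : mu A \is a fin_num by exact: fin_num_measure.
have mu1 : (fine (mu A))%:E = mu A by rewrite fineK.
have muA1 : fine (mu A) <= 1 by rewrite -lee_fin mu1 probability_le1.
have -> : (\prod_(i in [set: 'I_n]%SET) P (X i @^-1` ~` A) =
           \prod_(i in [set: 'I_n]%SET) (1 - fine (mu A))%:E)%E.
  apply: eq_bigr => i _.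
  have := lawX i _ mAC; rewrite /distribution /pushforward => ->.
  by rewrite probability_setC// EFinB mu1.
rewrite prodEFin lee_fin prodr_const cardsT card_ord -mulrN expRM_natl.
rewrite lerXn2r ?nnegrE ?expR_ge0 ?subr_ge0//.
apply: le_trans (expR_ge1Dx _); rewrite lerD2l lerN2.
by rewrite -lee_fin mu1.
Qed.

Lemma measure_bigsetU_le (I : eqType) (s : seq I) (A : I -> set T) (e : R) :
  (forall v, v \in s -> measurable (A v)) ->
  (forall v, v \in s -> (P (A v) <= e%:E)%E) ->
  measurable (\big[setU/set0]_(v <- s) A v) /\
  (P (\big[setU/set0]_(v <- s) A v) <= ((size s)%:R * e)%:E)%E.
Proof.
elim: s => [|v s IHs] mA Ae; first by rewrite !big_nil measure0 mul0r.
have [|w ws|mU PU] := IHs _ _.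
- by move=> w ws; apply: mA; rewrite inE ws orbT.
- by apply: Ae; rewrite inE ws orbT.
rewrite !big_cons; have mv : measurable (A v) by apply: mA; rewrite mem_head.
split; first exact: measurableU.
apply: (le_trans (measureU2 _ mv mU)).
rewrite /= -natr1 mulrDl mul1r addrC EFinD; apply: leeD => //.
by apply: Ae; rewrite mem_head.
Qed.

End Measurability.

(** * From a large Hausdorff distance to an empty cap *)

(** Let [q] be a direction along which the support function of [K] exceeds that
    of the sample by more than [c], [u] its normalisation and [lam *: v] its
    approximation in the net. Differences of points of [K] have norm at most
    [2], so passing from [u] to [lam *: v] costs at most [2 * dl <= c - eps];
    dividing by [lam <= 1] can only increase the remaining excess over [eps].
    Hence the support function of [K] exceeds every [<v, x i>] by more than
    [eps]. *)
Lemma uncovered_cap (R : realType) d (I : finType) (i0 : I) (K : set 'rV[R]_d)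
    (x : I -> 'rV[R]_d) (s : seq 'rV[R]_d) (dl eps c : R) :
  convex_body K -> K `<=` eball 0 1 -> (forall i, K (x i)) ->
  (forall u, enorm u = 1 -> exists2 v, v \in s &
     exists lam, [/\ 0 < lam, lam <= 1 & enorm (u - lam *: v) <= dl]) ->
  0 < eps -> eps + 2 * dl <= c -> 0 < c ->
  (c%:E < hausdorff_dist (convex_hull (range x)) K)%E ->
  exists2 v, v \in s & forall i, ~ cap K v eps (x i).
Proof.
move=> convK K1 Kx net e0 ec c0 chd.
have [cK _ [k0 /interior_subset Kk0]] := convK.
have K0 : K !=set0 by exists k0.
have [q0] := hausdorff_separates i0 convK c0 chd.
set q := map_mx ratr q0 => -[[i]|qx].
  have := dotp_le_supp_fun q cK (Kx i); have := enorm_ge0 q; nra.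
have [k Kk kE] := supp_fun_attained q cK K0.
have qk i : c * enorm q < dotp q (k - x i).
  by have := qx i; rewrite kE dotpBr; lra.
have q_neq0 : q != 0.
  apply/eqP => q0E; have := qk i0.
  by rewrite q0E enorm0 -(scale0r (0 : 'rV[R]_d)) dotpZl mulr0 mul0r ltxx.
have nq : 0 < enorm q.
  by rewrite lt0r enorm_ge0 andbT; apply: contra_neq q_neq0 => /enorm_eq0.
have [v vs [lam [lam0 lam1 uv]]] := net _ (enorm_unit q_neq0).
exists v => // i [_ /=]; apply/negP; rewrite -ltNge.
apply: lt_le_trans (lerB (dotp_le_supp_fun v cK Kk) (lexx eps)).
suff : eps < dotp v (k - x i) by rewrite dotpBr; lra.
have kx : enorm (k - x i) <= 2.
  have := K1 _ Kk; have := K1 _ (Kx i); rewrite /eball /= !subr0.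
  by have := enormD k (- x i); rewrite enormN; lra.
have : c < dotp ((enorm q)^-1 *: q) (k - x i).
  by rewrite dotpZl mulrC ltr_pdivlMr.
have := dotp_le_enorm ((enorm q)^-1 *: q - lam *: v) (k - x i).
rewrite dotpBl dotpZl (dotpZl lam).
have := enorm_ge0 (k - x i); have := enorm_ge0 ((enorm q)^-1 *: q - lam *: v).
set N := enorm (_ - _) in uv *; set D := dotp v _ => N0 E0 hN hc.
have : N * enorm (k - x i) <= 2 * dl by nra.
move=> hh; have : eps < lam * D by lra.
nra.
Qed.

(** * The deviation inequality *)

Theorem theorem1 (R : realType) (d : nat) (d_gt0 : (0 < d)%N)
  (alpha L eps0 : R) (alpha_gt0 : 0 < alpha) (L_gt0 : 0 < L)
  (eps0_gt0 : 0 < eps0) (eps0_le1 : eps0 <= 1)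
  (K : set 'rV[R]_d) (convK : convex_body K)
  (K_sub_ball : K `<=` eball (0 : 'rV[R]_d) 1)
  (mu : probability (borel_rV R d) R)
  (supp_mu : measure_support mu `<=` K)
  (cap_mass : forall (u : 'rV[R]_d) (eps : R), esphere u ->
     0 <= eps -> eps <= eps0 ->
     ((L * eps `^ alpha)%:E <= mu (cap K u eps))%E)
  (n : nat) (n_gt0 : (1 <= n)%N)
  (disp : measure_display) (T : measurableType disp) (P : probability T R)
  (X : 'I_n -> {RV P >-> borel_rV R d})
  (X_indep : mutually_independent X)
  (X_law : forall i : 'I_n, has_law (X i) mu) :
  let C := C_const alpha in
  let tau1 := Num.max 1 (d%:R / (C * alpha * L)) in
  let a := (tau1 * ln n%:R / n%:R) `^ (alpha^-1) in
  let b := n%:R `^ (- alpha^-1) in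
  forall x : R, 0 <= x -> a + b * x <= eps0 ->
  (P [set w | ((2 * a + 2 * b * x)%:E <=
               hausdorff_dist (convex_hull (range (fun i => X i w))) K)%E]
   <= (12 ^+ d * expR (- (C * L * x `^ alpha)))%:E)%E.
Proof.
move=> C tau1 a b x x0 eps_le.
set E := [set w | _].
have mE : measurable E by exact: measurable_hausdorff.
have [cK _ _] := convK.
have clK : closed K by apply: compact_closed => //; exact: norm_hausdorff.
have tau1_ge1 : 1 <= tau1 by rewrite le_max lexx.
have ab0 : 0 <= a + b * x by rewrite addr_ge0 ?mulr_ge0 ?powR_ge0.
have mcap u e : measurable (cap K u e : set (borel_rV R d)) by exact: measurable_cap.
have [n3|n3] := ltnP n 3.
  pose u : 'rV[R]_d := \row_i (i == Ordinal d_gt0)%:R.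
  have u1 : esphere u.
    rewrite /esphere /= /enorm /dotp (bigD1 (Ordinal d_gt0))//= big1 => [|i i0].
      by rewrite !mxE eqxx mulr1 addr0 sqrtr1.
    by rewrite !mxE (negPf i0) mulr0.
  have Leps : L * (a + b * x) `^ alpha <= 1.
    rewrite -lee_fin; apply: (le_trans (cap_mass u _ u1 ab0 eps_le)).
    exact: probability_le1.
  apply: (le_trans (probability_le1 P mE)); rewrite lee_fin.
  apply: (small_sample_bound alpha_gt0 L_gt0 (le_trans ler01 tau1_ge1) x0 d_gt0
    _ Leps).
  by rewrite n_gt0.
set eps := a + b * x in eps_le ab0.
have eps_gt0 : 0 < eps.
  rewrite ltr_pwDl ?mulr_ge0 ?powR_ge0// powR_gt0// !divr_gt0 ?ltr0n// mulr_gt0//.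
    exact: lt_le_trans tau1_ge1.
  exact: lt_le_trans (ln_ge1 n3).
(* The strict certificate of a distance at least [2 * eps] is only available at
   a smaller level, here [99/50 * eps]; hence a net of mesh slightly below
   [eps / 2], so that [99/50 * eps - 2 * (49/100 * eps) = eps]. *)
have dl0 : 0 < 49 / 100 * eps by rewrite mulr_gt0.
have [|s [s1 ssize snet]] := @sphere_net R d _ dl0.
  by rewrite -[leRHS]mulr1 ler_pM2l// (le_trans eps_le).
pose outside := \bigcup_(i : 'I_n) (X i @^-1` ~` K).
pose miss v := \bigcap_(i : 'I_n) (X i @^-1` ~` cap K v eps).
have mKC : measurable (~` K : set (borel_rV R d)).
  by apply: open_measurable_rV; exact: closed_openC.
have mout i : measurable (X i @^-1` ~` K) by exact: measurable_funPTI.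
have moutside : measurable outside.
  by apply: fin_bigcup_measurable => // i _.
have P_outside : P outside = 0%E.
  have [i _|i _|_] := @measure_bigsetU_le _ _ _ P _ (enum 'I_n)
    (fun i => X i @^-1` ~` K) 0.
  - exact: mout.
  - by have := X_law i _ mKC; rewrite /distribution /pushforward => ->;
      rewrite (support_measure0 clK supp_mu).
  rewrite mulr0 -bigcup_seq (_ : [set` enum 'I_n] = setT) => [P0|].
    by apply/eqP; rewrite eq_le P0 measure_ge0.
  by apply/seteqP; split => i //= _; rewrite mem_enum.
have mmiss v : v \in s -> measurable (miss v).
  move=> _; apply: fin_bigcap_measurable => // i _; apply: measurable_funPTI.
  exact: measurableC.
have P_miss v : v \in s ->
    (P (miss v) <= (expR (- (n%:R * (L * eps `^ alpha))))%:E)%E.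
  move=> vs; apply: probability_all_miss X_indep X_law _ _ => //.
  by apply: cap_mass => //; exact: s1.
have [mU PU] := measure_bigsetU_le mmiss P_miss.
have EU : E `<=` outside `|` \big[setU/set0]_(v <- s) miss v.
  move=> w Ew; have [out|inK] := pselect (outside w); [by left|right].
  have Kx i : K (X i w) by apply: contrapT => nK; apply: inK; exists i.
  have c0 : 0 < 99 / 50 * eps by rewrite mulr_gt0.
  have [||v vs vP] := @uncovered_cap R d _ (Ordinal n_gt0) K (fun i => X i w) s
    _ eps (99 / 50 * eps) convK K_sub_ball Kx snet eps_gt0 _ c0.
  - lra.
  - apply: lt_le_trans Ew; rewrite lte_fin.
    have -> : 2 * a + 2 * b * x = 2 * eps by rewrite /eps; ring.
    by rewrite ltr_pM2r//; lra.
  by rewrite -bigcup_seq; exists v => // i _; exact: vP.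
apply: (le_trans (le_measure P _ _ EU)); rewrite ?inE//; first exact: measurableU.
apply: (@le_trans _ _ (P outside + P (\big[setU/set0]_(v <- s) miss v))%E).
  exact: measureU2.
rewrite P_outside add0e.
apply: (le_trans PU); rewrite lee_fin.
apply: le_trans (union_bound_at_rate d alpha_gt0 L_gt0 x0 n3).
rewrite ler_wpM2r ?expR_ge0//.
have net_const (y : R) : y != 0 -> 12 / y = 147 / 25 / (49 / 100 * y).
  by move=> y0; field.
by rewrite net_const ?gt_eqF.
Qed.
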